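(* Let $f\in\mathbb C[x_1,\dots,x_n]$ with $f(0)=0$ be a polynomial whose Newton polyhedron $\Delta(f)$ has dimension $n$, and suppose that $f$ is non-degenerate at infinity. Then $$\mathcal K_\infty(f)\subset\bigcup_{\gamma}f_\gamma\big(\mathrm{Sing}\,f_\gamma\cap(\mathbb C^* )^{n}\big)\cup\{0\},$$ where $\gamma$ runs over all bad faces of $\Delta(f)$.
   Context: For $f(x)=\sum_\alpha a_\alpha x^\alpha$ let $supp(f)=\{\alpha\in(\mathbb Z_{\ge0})^n:a_\alpha\ne0\}$, let $\Delta(f)$ be the convex hull of $supp(f)$ in $\mathbb R^n$, and let $\widetilde\Gamma_-(f)$ be the convex hull of $supp(f)\cup\{0\}$. For a face $\gamma$, $f_\gamma(x)=\sum_{\alpha\in\gamma\cap supp(f)}a_\alpha x^\alpha$, and $\mathrm{Sing}\,f_\gamma$ is the set of critical points of $f_\gamma$. $f$ is non-degenerate at infinity if for every face $\gamma$ of $\widetilde\Gamma_-(f)$ not containing the origin, $f_\gamma$ has no critical point in $(\mathbb C^* )^n$ (equivalently, $\{x\in(\mathbb C^* )^n:f_\gamma(x)=0\}$ is smooth and reduced). A face $\gamma$ of $\Delta(f)$ is bad if (1) the affine subspace of dimension $\dim\gamma$ spanned by $\gamma$ contains the origin; and (2) there is a hyperplane $H\subset\mathbb R^n$ with equation $\sum_jp_jx_j=0$ such that $\gamma=H\cap\Delta(f)$ and $p_ip_j<0$ for some indices $i\ne j$. $\mathcal K_\infty(f)$, the set of asymptotic critical values of $f$, is the set of all values $\lim_{t\to0}f(X(t))\in\mathbb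 C$ for curves $X(t)=(x_1(t),\dots,x_n(t))$ in $\mathbb C^n$ with $\lim_{t\to0}\|X(t)\|=\infty$ and $\lim_{t\to0}x_i(t)\frac{\partial f}{\partial x_j}(X(t))=0$ for every pair $(i,j)\in\{1,\dots,n\}^2$. *)

(* Defs.v *)
From HB Require Import structures.
(* mpoly has to be imported before all_analysis: both declare postfix notations
   at level 2, with different associativities, and only this order is accepted. *)
From mathcomp Require Import all_boot all_order all_algebra.
From mathcomp Require Import mpoly complex.
From mathcomp Require Import all_classical all_reals all_analysis.

Set Implicit Arguments.
Unset Strict Implicit.
Unset Printing Implicit Defensive.

Import Order.TTheory GRing.Theory Num.Theory.
Import numFieldNormedType.Exports.

Local Open Scope classical_set_scope.
Local Open Scope ring_scope.

Section ConvexGeometry.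
Variables (R : realType) (n : nat).
Implicit Types (A P F : set 'rV[R]_n) (d : nat).

Definition dotp (p x : 'rV[R]_n) : R := \sum_(i < n) p 0 i * x 0 i.

Definition convex_hull A : set 'rV[R]_n := smallest (@convex_set R 'rV[R]_n) A.

Definition affine_set A : Prop :=
  forall (x y : 'rV[R]_n) (t : R), A x -> A y -> A ((1 - t) *: x + t *: y).

Definition affine_hull A : set 'rV[R]_n := smallest affine_set A.

(* The dimension of A is that of its affine hull; the empty set has no
   dimension in this sense. *)
Definition has_dim A d : Prop :=
  exists (x : 'rV[R]_n) (V : {vspace 'rV[R]_n}),
    affine_hull A = [set x + v | v in [set` V]] /\ \dim V = d.

(* Nonempty faces of P; the choice u = 0, c = 0 gives the improper face P. *)
Definition is_face P F : Prop :=
  F !=set0 /\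
  exists (u : 'rV[R]_n) (c : R),
    (forall x, P x -> c <= dotp u x) /\ F = P `&` [set x | dotp u x = c].

End ConvexGeometry.

Section NewtonPolyhedra.
Variables (R : realType) (n : nat).
Implicit Types (f : {mpoly R[i][n]}) (F : set 'rV[R]_n).

Definition exponent (m : 'X_{1..n}) : 'rV[R]_n := \row_(i < n) (m i)%:R.

Definition supp f : set 'rV[R]_n := [set exponent m | m in [set` msupp f]].

Definition newton f : set 'rV[R]_n := convex_hull (supp f).

Definition newton_infty f : set 'rV[R]_n := convex_hull (supp f `|` [set 0]).

Definition face_part f F : {mpoly R[i][n]} :=
  \sum_(m <- msupp f | `[< F (exponent m) >]) f@_m *: 'X_[m].

Definition Sing f : set ('I_n -> R[i]) :=
  [set x | forall i : 'I_n, (f^`M(i)).@[x] = 0].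

Definition torus : set ('I_n -> R[i]) := [set x | forall i : 'I_n, x i != 0].

Definition nondegenerate_at_infinity f : Prop :=
  forall F, is_face (newton_infty f) F -> ~ F 0 ->
    Sing (face_part f F) `&` torus = set0.

Definition bad_face f F : Prop :=
  [/\ is_face (newton f) F,
      affine_hull F 0
    & exists p : 'rV[R]_n,
        F = [set x | dotp p x = 0] `&` newton f /\
        exists i j : 'I_n, i != j /\ p 0 i * p 0 j < 0].

End NewtonPolyhedra.

Section AsymptoticCriticalValues.
Variables (R : realType) (n : nat).

Definition euclidean_norm (x : 'I_n -> R[i]) : R :=
  Num.sqrt (\sum_(i < n) Normc.normc (x i) ^+ 2).

(* The topology on the complex numbers is that of R[i]^o, i.e. of the field
   R[i] seen as a normed space over itself. A curve is a map from the reals whose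
   values matter only on some interval ]0, e[, where it is continuous. *)
Definition Kinfty (f : {mpoly R[i][n]}) : set R[i] :=
  [set c | exists X : R -> 'I_n -> R[i],
    [/\ forall i : 'I_n, \forall t \near (0 : R)^'+,
          {for t, continuous (fun s => X s i : R[i]^o)},
        euclidean_norm (X t) @[t --> (0 : R)^'+] --> +oo,
        forall i j : 'I_n,
          (X t i * (f^`M(j)).@[X t] : R[i]^o) @[t --> (0 : R)^'+] --> (0 : R[i]^o)
      & (f.@[X t] : R[i]^o) @[t --> (0 : R)^'+] --> (c : R[i]^o)]].

End AsymptoticCriticalValues.

(* Main.v *)
Require Import Defs.
From mathcomp Require Import all_boot all_order all_algebra.
From mathcomp Require Import mpoly complex.
From mathcomp Require Import all_classical all_reals all_analysis.
From mathcomp Require Import ring lra.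

Import Order.TTheory GRing.Theory Num.Theory.
Import numFieldNormedType.Exports.

Local Open Scope classical_set_scope.
Local Open Scope ring_scope.

(** An asymptotic critical value c of f is seen along a family of points x(t)
    leaving every compact set, with all x_i df/dx_i tending to 0. After a small
    perturbation the x(t) lie in the torus, and an ultrafilter finer than the
    filter of right neighbourhoods of 0 makes every real function of t either
    bounded or tend to an infinity. The part of the exponents of a Puiseux
    parametrization is played by a real vector p(t), as follows.

    Put l_i = ln |x_i|. The vectors u such that the pairing of u with l stays
    bounded form a linear subspace; subtracting from l(t) its components along
    that subspace gives p(t), at bounded distance from l(t) and exactly
    orthogonal to the subspace (rectification). Hence x_i = exp(p_i) y_i where y
    converges to a point y0 of the torus (torus_rescaling). If f is nonzero, one
    of its exponents a maximizes the pairing <p, a> along the ultrafilter; let G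
    be the set of exponents m of f for which <p, m - a> stays bounded, that is,
    for which <p, m> = <p, a> for every t. For the other m, <p, m - a> tends to
    -oo. So, for most t, p(t) cuts out a face F whose exponents in the support
    of f are those of G, and every sum of monomials of f, with arbitrary
    coefficients, is exp <p, a> times a quantity which tends to the
    corresponding sum over G at y0 (dominant_terms). This applies to f and to
    all x_i df/dx_i.

    - If <p, a> tends to +oo, then y0 is a critical point of f_F, while F is a
      face of the polyhedron at infinity which misses the origin: this
      contradicts nondegeneracy.
    - If <p, a> tends to -oo, then f(x(t)) tends to 0, so c = 0.
    - If <p, a> is bounded, it vanishes, hence c = f_F(y0), where y0 is critical
      for f_F and F is the section of the polyhedron by the hyperplane
      orthogonal to p(t). Some p_i(t) is positive because x(t) is unbounded;
      some p_j(t) is negative because otherwise all exponents of f would lie on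
      that hyperplane, and the polyhedron would not have dimension n. Finally,
      either the affine hull of F contains the origin, and F is bad, or some
      linear form is a nonzero constant on F; then f_F is quasi-homogeneous and
      Euler's relation gives c = f_F(y0) = 0. *)

Set Implicit Arguments.
Unset Strict Implicit.
Unset Printing Implicit Defensive.

(** * Real functions along an ultrafilter *)

Definition bounded_along (R : realType) (T : Type) (U : set_system T)
    (g : T -> R) : Prop :=
  exists M : R, \forall t \near U, `|g t| <= M.

Lemma near_all_in (T : Type) (F : set_system T) {FF : Filter F} (I : eqType)
    (s : seq I) (P : I -> T -> Prop) :
  {in s, forall i, \forall t \near F, P i t} ->
  \forall t \near F, {in s, forall i, P i t}.
Proof.
elim: s => [|i s IH] sP; first by apply: filterE.
have Pi := sP i (mem_head i s).
have Ps : \forall t \near F, {in s, forall i, P i t}.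
  by apply: IH => j js; apply: sP; rewrite in_cons js orbT.
apply: filterS2 Pi Ps => t Pi Ps j; rewrite in_cons => /orP[/eqP -> //|].
exact: Ps.
Qed.

Section Ultrafilters.
Variables (R : realType) (T : Type) (U : set_system T).
Hypothesis UU : UltraFilter U.
Implicit Types g h : T -> R.

Let UP : ProperFilter U := @ultra_proper _ _ UU.
Existing Instance UP.

(** This takes the place of the passage to subsequences. *)
Lemma ultra_trichotomy g :
  [\/ bounded_along U g, g @ U --> +oo | g @ U --> -oo].
Proof.
have [gb|gb] := pselect (bounded_along U g); first by constructor 1.
have big M : \forall t \near U, M < `|g t|.
  have [gM|] := in_ultra_setVsetC [set t | `|g t| <= M] UU.
    by case: gb; exists M.
  by apply: filterS => t /= /negP; rewrite -ltNge.
have [gp|gn] := in_ultra_setVsetC [set t | 0 <= g t] UU.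
  constructor 2; apply/cvgryPge => A; near=> t.
  have: A < `|g t| by near: t; exact: big.
  by rewrite ger0_norm; [exact: ltW|near: t].
constructor 3; apply/cvgrNyPle => A; near=> t.
have: - A < `|g t| by near: t; exact: big.
have /negP: ~ 0 <= g t by near: t.
by rewrite -ltNge => gt0; rewrite ltr0_norm // ltrN2 => /ltW.
Unshelve. all: by end_near. Qed.

(** If each P i failed on a set of the ultrafilter, so would they all together
    on the intersection of these finitely many sets. *)
Lemma ultra_pigeonhole (I : finType) (P : I -> set T) :
  (\forall t \near U, exists i, P i t) -> exists i, \forall t \near U, P i t.
Proof.
move=> UE; apply: contrapT => nP.
have nUP i : \forall t \near U, ~ P i t.
  by have [UPi|//] := in_ultra_setVsetC (P i) UU; case: nP; exists i.
have : \forall t \near U, False.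
  have := filter_forall UP nUP.
  by apply: filterS2 UE => t [i Pit] /(_ i).
by move/filter_ex => [].
Qed.

(** By compactness the values of g cluster somewhere, and a cluster point of an
    ultrafilter is a limit. *)
Lemma bounded_cvg g : bounded_along U g -> exists l : R, g @ U --> l.
Proof.
case=> M gM.
have [|l [_ clust]] := @segment_compact R (- M) M (g @ U) _.
  by apply: filterS gM => t /=; rewrite in_itv /= ler_norml.
exists l => N lN.
have [//|UN] := in_ultra_setVsetC (g @^-1` N) UU.
by have [x [/= nNx Nx]] := clust (~` N) N UN lN.
Qed.

Lemma bounded_alongD g h : bounded_along U g -> bounded_along U h ->
  bounded_along U (fun t => g t + h t).
Proof.
move=> [M gM] [N hN]; exists (M + N); near=> t.
by apply: le_trans (ler_normD _ _) _; apply: lerD; near: t.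
Unshelve. all: by end_near. Qed.

Lemma bounded_alongZ (a : R) g : bounded_along U g ->
  bounded_along U (fun t => a * g t).
Proof.
move=> [M gM]; exists (`|a| * M); near=> t.
by rewrite normrM ler_wpM2l //; near: t.
Unshelve. all: by end_near. Qed.

Lemma bounded_along_sum (I : Type) (s : seq I) (G : I -> T -> R) :
  (forall i, bounded_along U (G i)) ->
  bounded_along U (fun t => \sum_(i <- s) G i t).
Proof.
move=> bG; elim: s => [|i s IH].
  by exists 0; near=> t; rewrite big_nil normr0.
have [M HM] := bounded_alongD (bG i) IH.
by exists M; apply: filterS HM => t; rewrite big_cons.
Unshelve. all: by end_near. Qed.

Lemma bounded_not_pinfty g : bounded_along U g -> ~ g @ U --> +oo.
Proof.
move=> [M gM] /cvgryPgt/(_ M) gi.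
have [t [/= le lt]] := filter_ex (filterI gM gi).
by move: (le_lt_trans (le_trans (ler_norm _) le) lt); rewrite ltxx.
Qed.

Lemma pinfty_shift g h : bounded_along U (fun t => h t - g t) ->
  h @ U --> +oo -> g @ U --> +oo.
Proof.
move=> [M hM] /cvgryPge hy; apply/cvgryPge => A; near=> t.
have : `|h t - g t| <= M by near: t.
have : A + M <= h t by near: t; exact: hy.
by rewrite ler_norml => ? /andP[? ?]; lra.
Unshelve. all: by end_near. Qed.

End Ultrafilters.

(** * Limits of complex functions and of polynomials *)

Section ComplexModulus.
Local Open Scope complex_scope.
Variable R : realType.

Lemma normc_ge0 (z : R[i]) : 0 <= Normc.normc z.
Proof. by case: z => a b; exact: sqrtr_ge0. Qed.

Lemma normc_real (a : R) : Normc.normc a%:C = `|a|.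
Proof. by rewrite /Normc.normc /= expr0n addr0 sqrtr_sqr. Qed.

End ComplexModulus.

Section ComplexLimits.
Local Open Scope complex_scope.
Variables (R : realType) (T : Type) (F : set_system T).
Context {FF : Filter F}.
Implicit Types (z w : T -> R[i]) (l : R[i]).

(** The norm of R[i] as a normed field is complex-valued; this restates
    convergence with the real modulus and real tolerances. *)
Lemma cvgc_distP z l : ((z t : R[i]^o) @[t --> F] --> (l : R[i]^o)) <->
  forall e : R, 0 < e -> \forall t \near F, Normc.normc (z t - l) <= e.
Proof.
have E t : `|(l : R[i]^o) - z t| = (Normc.normc (z t - l))%:C.
  by rewrite distrC; case: (z t - l).
rewrite (@cvgrPdist_le _ R[i]^o _ F _ (fun t => z t : R[i]^o) (l : R[i]^o)).
split=> H e e0.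
  have := H e%:C; rewrite ltcR => /(_ e0).
  by apply: filterS => t; rewrite E lecR.
move: e0; rewrite ltcE => /andP[/eqP e0 e1]; have := H _ e1.
by apply: filterS => t; rewrite E lecE e0 eqxx.
Qed.

Lemma cvgcM z w (a b : R[i]) : ((z t : R[i]^o) @[t --> F] --> (a : R[i]^o)) ->
  ((w t : R[i]^o) @[t --> F] --> (b : R[i]^o)) ->
  ((z t * w t : R[i]^o) @[t --> F] --> (a * b : R[i]^o)).
Proof. exact: (@cvgM R[i] T F FF z w a b). Qed.

Lemma cvgcD z w (a b : R[i]) : ((z t : R[i]^o) @[t --> F] --> (a : R[i]^o)) ->
  ((w t : R[i]^o) @[t --> F] --> (b : R[i]^o)) ->
  ((z t + w t : R[i]^o) @[t --> F] --> (a + b : R[i]^o)).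
Proof. exact: (@cvgD R[i] R[i]^o T F FF z w a b). Qed.

Lemma cvgc_prod (I : Type) (s : seq I) (z : I -> T -> R[i]) (l : I -> R[i]) :
  (forall i, (z i t : R[i]^o) @[t --> F] --> (l i : R[i]^o)) ->
  ((\prod_(i <- s) z i t : R[i]^o) @[t --> F] --> (\prod_(i <- s) l i : R[i]^o)).
Proof.
move=> zl; elim: s => [|i s IH].
  by rewrite big_nil; under eq_fun do rewrite big_nil; exact: cvg_cst.
by rewrite big_cons; under eq_fun do rewrite big_cons; exact: (cvgcM (zl i) IH).
Qed.

Lemma cvgc_sum (I : eqType) (s : seq I) (z : I -> T -> R[i]) (l : I -> R[i]) :
  {in s, forall i, (z i t : R[i]^o) @[t --> F] --> (l i : R[i]^o)} ->
  ((\sum_(i <- s) z i t : R[i]^o) @[t --> F] --> (\sum_(i <- s) l i : R[i]^o)).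
Proof.
elim: s => [|i s IH] zl.
  by rewrite big_nil; under eq_fun do rewrite big_nil; exact: cvg_cst.
rewrite big_cons; under eq_fun do rewrite big_cons.
have zi := zl i (mem_head i s).
apply: (cvgcD zi); apply: IH => j js.
by apply: zl; rewrite in_cons js orbT.
Qed.

Lemma cvgc_monomial (n : nat) (z : T -> 'I_n -> R[i]) (l : 'I_n -> R[i]) (m : 'X_{1..n}) :
  (forall i, (z t i : R[i]^o) @[t --> F] --> (l i : R[i]^o)) ->
  ((\prod_i z t i ^+ m i : R[i]^o) @[t --> F] --> (\prod_i l i ^+ m i : R[i]^o)).
Proof.
move=> zl; apply: cvgc_prod => i; elim: (m i) => [|k IH].
  by under eq_fun do rewrite expr0; exact: cvg_cst.
by rewrite exprS; under eq_fun do rewrite exprS; exact: (cvgcM (zl i) IH).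
Qed.

Lemma cvgc_meval (n : nat) (f : {mpoly R[i][n]}) (z : T -> 'I_n -> R[i]) (l : 'I_n -> R[i]) :
  (forall i, (z t i : R[i]^o) @[t --> F] --> (l i : R[i]^o)) ->
  ((f.@[z t] : R[i]^o) @[t --> F] --> (f.@[l] : R[i]^o)).
Proof.
move=> zl; rewrite mevalE; under eq_fun do rewrite mevalE.
apply: cvgc_sum => m _.
have c : ((f@_m : R[i]^o) @[_ --> F] --> (f@_m : R[i]^o)) by exact: cvg_cst.
exact: (cvgcM c (cvgc_monomial (m := m) zl)).
Qed.

Lemma cvgc_real (g : T -> R) (a : R) :
  g @ F --> a -> (((g t)%:C : R[i]^o) @[t --> F] --> (a%:C : R[i]^o)).
Proof.
move=> /cvgrPdist_le ga; apply/cvgc_distP => e /ga; apply: filterS => t.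
by rewrite distrC -rmorphB /= /Normc.normc expr0n addr0 sqrtr_sqr.
Qed.

Lemma bounded_cvgc (UF : UltraFilter F) z : bounded_along F (fun t => Normc.normc (z t)) ->
  exists l : R[i], (z t : R[i]^o) @[t --> F] --> (l : R[i]^o).
Proof.
move=> [M HM].
have ReIm (x y : R) : `|x| <= Normc.normc (x +i* y) /\ `|y| <= Normc.normc (x +i* y).
  by rewrite /Normc.normc -!sqrtr_sqr; split; apply: ler_wsqrtr; rewrite ?lerDl ?lerDr sqr_ge0.
have Re_b : bounded_along F (fun t => complex.Re (z t)).
  exists M; apply: filterS HM => t; rewrite ger0_norm ?normc_ge0 //.
  by apply: le_trans; case: (z t) => x y; case: (ReIm x y).
have Im_b : bounded_along F (fun t => complex.Im (z t)).
  exists M; apply: filterS HM => t; rewrite ger0_norm ?normc_ge0 //.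
  by apply: le_trans; case: (z t) => x y; case: (ReIm x y).
have [a za] := bounded_cvg UF Re_b; have [b zb] := bounded_cvg UF Im_b.
exists (a%:C + 'i%C * b%:C); under eq_fun do rewrite (complexE (z _)).
apply: (cvgcD (cvgc_real za)).
have c : (('i%C : R[i]^o) @[_ --> F] --> ('i%C : R[i]^o)) by exact: cvg_cst.
exact: (cvgcM c (cvgc_real zb)).
Qed.

End ComplexLimits.

Lemma cvgc_unique (R : realType) (T : Type) (U : set_system T)
    {UP : ProperFilter U} (z : T -> R[i]) (a b : R[i]) :
  ((z t : R[i]^o) @[t --> U] --> (a : R[i]^o)) ->
  ((z t : R[i]^o) @[t --> U] --> (b : R[i]^o)) -> a = b.
Proof. exact: (@cvg_unique R[i]^o (@norm_hausdorff R[i] R[i]^o)). Qed.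

Section UnboundedFamilies.
Variables (R : realType) (n : nat) (T : Type) (U : set_system T).
Hypothesis UU : UltraFilter U.
Let UP : ProperFilter U := @ultra_proper _ _ UU.
Existing Instance UP.

(** If no coordinate tends to infinity in modulus, all are bounded along the
    ultrafilter, and so is the Euclidean norm. *)
Lemma norm_pinfty_coord (X : T -> 'I_n -> R[i]) :
  euclidean_norm (X t) @[t --> U] --> +oo ->
  exists i, Normc.normc (X t i) @[t --> U] --> +oo.
Proof.
move=> Xy; apply: contrapT => nXy.
have bX i : bounded_along U (fun t => Normc.normc (X t i)).
  have [//|Xiy|/cvgrNyPlt/(_ 0)/filter_ex[t]] :=
      ultra_trichotomy UU (fun t => Normc.normc (X t i)).
    by case: nXy; exists i.
  by rewrite ltNge normc_ge0.
have [M XM] := choice bX.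
apply: (bounded_not_pinfty UU _ Xy); exists (Num.sqrt (\sum_i M i ^+ 2)).
apply: filterS (filter_forall UP XM) => t tM.
rewrite ger0_norm ?sqrtr_ge0 // ler_wsqrtr // ler_sum // => i _.
by rewrite ler_sqr ?nnegrE ?normc_ge0 //; have := tM i; rewrite ger0_norm ?normc_ge0 //;
  exact: le_trans (normc_ge0 _).
Qed.

End UnboundedFamilies.

(** * The Euclidean pairing and bounded linear relations *)

Section Pairing.
Variables (R : realType) (n : nat).

Lemma dotpDl (p q x : 'rV[R]_n) : dotp (p + q) x = dotp p x + dotp q x.
Proof. by rewrite /dotp -big_split; apply: eq_bigr => i _; rewrite mxE mulrDl. Qed.

Lemma dotpC (p x : 'rV[R]_n) : dotp p x = dotp x p.
Proof. by apply: eq_bigr => i _; rewrite mulrC. Qed.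

Lemma dotpDr (p x y : 'rV[R]_n) : dotp p (x + y) = dotp p x + dotp p y.
Proof. by rewrite !(dotpC p) dotpDl. Qed.

Lemma dotpZl a (p x : 'rV[R]_n) : dotp (a *: p) x = a * dotp p x.
Proof. by rewrite /dotp mulr_sumr; apply: eq_bigr => i _; rewrite mxE mulrA. Qed.

Lemma dotpZr a (p x : 'rV[R]_n) : dotp p (a *: x) = a * dotp p x.
Proof. by rewrite !(dotpC p) dotpZl. Qed.

Lemma dotpNl (p x : 'rV[R]_n) : dotp (- p) x = - dotp p x.
Proof. by rewrite -scaleN1r dotpZl mulN1r. Qed.

Lemma dotp0l (x : 'rV[R]_n) : dotp 0 x = 0.
Proof. by rewrite -(scale0r 0) dotpZl mul0r. Qed.

Lemma dotpE (p x : 'rV[R]_n) : dotp p x = (x *m p^T) 0 0.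
Proof. by rewrite mxE; apply: eq_bigr => i _; rewrite mxE mulrC. Qed.

End Pairing.

Section RelationSpace.
Variables (R : realType) (n : nat) (T : Type) (U : set_system T).
Hypothesis UU : UltraFilter U.
Implicit Types (u : 'rV[R]_n).

Let UP : ProperFilter U := @ultra_proper _ _ UU.
Existing Instance UP.

Definition rel_bounded (l : T -> 'rV[R]_n) u : Prop :=
  bounded_along U (fun t => dotp u (l t)).

(** Take a free family of bounded relations of maximal size: a bounded relation
    outside its span would enlarge it. *)
Lemma bounded_relations_span (l : T -> 'rV[R]_n) :
  exists r (B : 'M[R]_(r, n)), [/\ row_free B,
    forall k, rel_bounded l (row k B)
    & forall u, rel_bounded l u -> (u <= B)%MS].
Proof.
pose P r := `[< exists B : 'M[R]_(r, n), row_free B /\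
  forall k, rel_bounded l (row k B) >].
have P0 : exists r, P r.
  exists 0; apply/asboolP; exists 0; split; first by rewrite -row_leq_rank.
  by case.
have Pn r : P r -> (r <= n)%N.
  move=> /asboolP[B [fB _]].
  apply: (@leq_trans (\rank B)); first by rewrite row_leq_rank.
  exact: rank_leq_col.
case: (ex_maxnP P0 Pn) => r /asboolP[B [fB bB]] maxr.
exists r, B; split=> // u bu; apply: contraT => nuB.
suff /maxr : P (1 + r)%N by rewrite add1n ltnn.
have bC k : rel_bounded l (row k (col_mx u B)).
  case: (split_ordP k) => j ->.
    suff -> : row (lshift r j) (col_mx u B) = u by [].
    by apply/rowP => i; rewrite rowKu mxE ord1.
  suff -> : row (rshift 1 j) (col_mx u B) = row j B by [].
  by apply/rowP => i; rewrite rowKd.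
apply/asboolP; exists (col_mx u B); split=> //.
rewrite -row_leq_rank -addsmxE add1n -[X in (X < _)%N](eqP fB).
apply: rank_ltmx; rewrite ltmxE addsmxSr /=.
by apply: contra nuB; apply: submx_trans; exact: addsmxSl.
Qed.

(** With a basis B of the bounded relations and a right inverse C of B, the
    vector l - l B^T C^T is annihilated by B, and the correction is bounded
    since l B^T lists the values of the basic relations. Exact vanishing is the
    point: the exponents on which l is nearly constant become the points of a
    hyperplane section. *)
Lemma rectification (l : T -> 'rV[R]_n) : exists p : T -> 'rV[R]_n,
  (forall i, bounded_along U (fun t => l t 0 i - p t 0 i)) /\
  forall u, rel_bounded l u -> forall t, dotp u (p t) = 0.
Proof.
have [r [B [/row_freeP[C BC] bB uB]]] := bounded_relations_span l.
exists (fun t => l t - l t *m B^T *m C^T); split=> [i|u /uB/submxP[D ->] t].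
  have := @bounded_along_sum R T U UU _ (index_enum _)
    (fun k t => C i k * dotp (row k B) (l t))
    (fun k => bounded_alongZ UU (C i k) (bB k)).
  case=> M HM; exists M; apply: filterS HM => t.
  rewrite !mxE opprB addrC subrK; congr (`|_| <= _); apply: eq_bigr => k _.
  rewrite mulrC [C^T _ _]mxE; congr (_ * _); rewrite mxE dotpC.
  by apply: eq_bigr => j _; rewrite !mxE.
rewrite dotpE mulmxBl trmx_mul !mulmxA -!(mulmxA _ C^T) -trmx_mul BC trmx1.
by rewrite mulmx1 subrr mxE.
Qed.

End RelationSpace.

(** * Hulls and weights *)

Section FacesAndHulls.
Variables (R : realType) (n : nat).
Implicit Types (A : set 'rV[R]_n) (u x : 'rV[R]_n) (c : R).

Lemma convex_hull_ge A u c : (forall x, A x -> c <= dotp u x) ->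
  forall x, convex_hull A x -> c <= dotp u x.
Proof.
move=> Ac; apply: (@smallest_sub _ _ A [set x | c <= dotp u x] _ Ac) => x y k.
rewrite !inE /= => cx cy.
rewrite dotpDr !dotpZr -[leLHS]mul1r -(subrK k%:num 1) mulrDl addrC lerD //.
  by rewrite ler_wpM2l.
by rewrite ler_wpM2l // subr_ge0.
Qed.

Lemma affine_hull_dotp A u c : (forall x, A x -> dotp u x = c) ->
  forall x, affine_hull A x -> dotp u x = c.
Proof.
move=> Ac; apply: (@smallest_sub _ _ A [set x | dotp u x = c] _ Ac) => x y t /= xc yc.
by rewrite dotpDr !dotpZr xc yc -mulrDl subrK mul1r.
Qed.

Lemma affine_hull_affine A : affine_set (affine_hull A).
Proof. by move=> x y t Ax Ay B AB; apply: AB.1; [exact: Ax|exact: Ay]. Qed.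

(** The directions of an affine set at one of its points are stable by scaling,
    and by sums since a + (v + w) lies on the line through a and the midpoint of
    a + v and a + w. *)
Lemma affine_set_submx A m (D : 'M[R]_(m, n)) a u : affine_set A -> A a ->
  (forall k, A (a + row k D)) -> (u <= D)%MS -> A (a + u).
Proof.
move=> affA Aa AD /submxP[c ->].
have dirZ v s : A (a + v) -> A (a + s *: v).
  move=> Av; have := affA _ _ s Aa Av.
  by rewrite scalerDr addrA -scalerDl subrK scale1r.
have dirD v w : A (a + v) -> A (a + w) -> A (a + (v + w)).
  move=> Av Aw; have := affA _ _ 2^-1 Av Aw.
  suff -> : (1 - 2^-1) *: (a + v) + 2^-1 *: (a + w) = a + 2^-1 *: (v + w).
    by move=> /(dirZ _ 2); rewrite scalerA divff ?scale1r // pnatr_eq0.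
  by apply/rowP => i; rewrite !mxE; lra.
rewrite mulmx_sum_row; elim/big_ind: _ => [|v w Av Aw|k _].
- by rewrite addr0.
- exact: dirD.
- exact/dirZ.
Qed.

(** If - a is a combination of the differences x - a, the affine hull contains
    a - a = 0. Otherwise a linear form vanishes on these differences and not
    on a. *)
Lemma affine_hull0_or_weight A (s : seq 'rV[R]_n) a : A a -> {in s, forall x, A x} ->
  affine_hull A 0 \/ exists w, dotp w a != 0 /\ {in s, forall x, dotp w x = dotp w a}.
Proof.
move=> Aa As; pose D := \matrix_(k < size s) (nth 0 s k - a).
have AD k : affine_hull A (a + row k D).
  by rewrite rowK addrC subrK; apply: sub_gen_smallest; apply: As; exact: mem_nth.
have [aD|aD] := boolP (- a <= D)%MS.
  left; rewrite -(subrr a).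
  exact: affine_set_submx (@affine_hull_affine A) (sub_gen_smallest Aa) AD aD.
right.
have /rV0Pn[j aj] : a *m cokermx D != 0.
  by apply: contra aD; rewrite submxE mulNmx oppr_eq0.
have wE x : dotp (col j (cokermx D))^T x = (x *m cokermx D) 0 j.
  by rewrite mxE; apply: eq_bigr => i _; rewrite !mxE mulrC.
exists (col j (cokermx D))^T; split=> [|x xs]; first by rewrite wE.
have xi : (index x s < size s)%N by rewrite index_mem.
have : row (Ordinal xi) D *m cokermx D = 0 by rewrite -row_mul mulmx_coker row0.
rewrite !wE rowK /= nth_index // mulmxBl => /eqP; rewrite subr_eq0.
by move=> /eqP ->.
Qed.

End FacesAndHulls.

(** * Newton polyhedra and Euler relations *)

Section NewtonPolynomials.
Local Open Scope complex_scope.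
Variables (R : realType) (n : nat).
Implicit Types (f : {mpoly R[i][n]}) (F : set 'rV[R]_n) (x : 'I_n -> R[i]).

Lemma newton_msupp f m : m \in msupp f -> newton f (exponent R m).
Proof. by move=> mf; apply: sub_gen_smallest; exists m. Qed.

Lemma newton_infty_msupp f m : m \in msupp f -> newton_infty f (exponent R m).
Proof. by move=> mf; apply: sub_gen_smallest; left; exists m. Qed.

(** A linear form vanishing on the support vanishes on the affine hull of the
    polyhedron, which is the whole space in full dimension. *)
Lemma full_dim_dotp_eq0 f (p : 'rV[R]_n) : has_dim (newton f) n ->
  (forall m, m \in msupp f -> dotp p (exponent R m) = 0) -> p = 0.
Proof.
move=> [x [V [hullE dimV]]] p0.
have hull0 v : affine_hull (newton f) v -> dotp p v = 0.
  apply: affine_hull_dotp => w nw; apply/eqP.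
  have ge0 : 0 <= dotp p w.
    by apply: convex_hull_ge nw => _ [m mf <-]; rewrite p0.
  have : 0 <= dotp (- p) w.
    by apply: convex_hull_ge nw => _ [m mf <-]; rewrite dotpNl p0 ?oppr0.
  by rewrite dotpNl oppr_ge0 => le0; rewrite eq_le le0 ge0.
have VT : V = fullv by apply/eqP; rewrite eqEdim subvf /= dimvf dimV /dim /= mul1n.
have hullT v : affine_hull (newton f) v.
  rewrite hullE; exists (v - x); last by rewrite addrC subrK.
  by rewrite VT; exact: memvf.
apply/rowP => i; rewrite mxE -[RHS](hull0 (delta_mx 0 i)) //.
rewrite /dotp (bigD1 i) //= big1 => [|j ji]; rewrite mxE ?eqxx ?mulr1 ?addr0 //.
by rewrite (negbTE ji) mulr0.
Qed.

Lemma euler_sum (s : seq 'X_{1..n}) (P : pred 'X_{1..n}) (b : 'X_{1..n} -> R[i]) x i :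
  x i * ((\sum_(m <- s | P m) b m *: 'X_[m])^`M(i)).@[x] =
  \sum_(m <- s | P m) b m * (m i)%:R * \prod_j x j ^+ m j.
Proof.
rewrite (raddf_sum (mderiv i)) (raddf_sum (meval x)) mulr_sumr.
apply: eq_bigr => m _; rewrite /= mderivZ mderivX !mevalZ -!mulrA mulrCA.
congr (_ * _).
(* The exponent m - U_(i) is truncated when m i = 0; the factor m i then kills
   the term. *)
have [mi0|mi0] := eqVneq (m i) 0; first by rewrite mi0 !mul0r mulr0.
rewrite mulrCA; congr (_ * _); rewrite mevalX.
rewrite (bigD1 i) //= [RHS](bigD1 i) //= mulrA; congr (_ * _).
  by rewrite mnmBE mnmE eqxx -exprS subn1 prednK // lt0n.
by apply: eq_bigr => j ji; rewrite mnmBE mnm1E eq_sym (negbTE ji) subn0.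
Qed.

Lemma face_part_meval f F x : (face_part f F).@[x] =
  \sum_(m <- msupp f | `[< F (exponent R m) >]) f@_m * \prod_j x j ^+ m j.
Proof.
rewrite /face_part (raddf_sum (meval x)).
by apply: eq_bigr => m _; rewrite /= mevalZ mevalX.
Qed.

Lemma face_part_euler f F x i : x i * ((face_part f F)^`M(i)).@[x] =
  \sum_(m <- msupp f | `[< F (exponent R m) >])
     f@_m * (m i)%:R * \prod_j x j ^+ m j.
Proof. exact: euler_sum. Qed.

Lemma euler f x i : x i * (f^`M(i)).@[x] =
  \sum_(m <- msupp f) f@_m * (m i)%:R * \prod_j x j ^+ m j.
Proof. by rewrite {1}(mpolyE f) euler_sum. Qed.

End NewtonPolynomials.

(** * Dominant terms of sums of monomials *)

Section DominantTerms.
Local Open Scope complex_scope.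
Variables (R : realType) (n : nat) (T : Type) (F : set_system T).
Context {FF : Filter F}.
Variables (p : T -> 'rV[R]_n) (y : T -> 'I_n -> R[i]) (y0 : 'I_n -> R[i]).
Hypothesis yy0 : forall i, (y t i : R[i]^o) @[t --> F] --> (y0 i : R[i]^o).
Let X t i : R[i] := (expR (p t 0 i))%:C * y t i.

Lemma monomial_scaling t (m : 'X_{1..n}) : \prod_i X t i ^+ m i =
  (expR (dotp (p t) (exponent R m)))%:C * \prod_i y t i ^+ m i.
Proof.
under eq_bigr do rewrite exprMn -rmorphXn /= -expRM_natr.
rewrite big_split /=; congr (_ * _); rewrite -rmorph_prod /= -expR_sum.
by congr (expR _)%:C; apply: eq_bigr => i _; rewrite mxE.
Qed.

(** After division by the size of the monomial m0, a monomial has the size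
    exp <p, m - m0>, which is eventually 1 on G and tends to 0 elsewhere. The
    coefficients b are free so as to cover f and its logarithmic derivatives
    alike. *)
Lemma dominant_terms (s : seq 'X_{1..n}) (b : 'X_{1..n} -> R[i])
    (m0 : 'X_{1..n}) (G : pred 'X_{1..n}) :
  {in s, forall m, G m ->
    \forall t \near F, dotp (p t) (exponent R m) = dotp (p t) (exponent R m0)} ->
  {in s, forall m, ~~ G m ->
    dotp (p t) (exponent R m) - dotp (p t) (exponent R m0) @[t --> F] --> -oo} ->
  (((expR (- dotp (p t) (exponent R m0)))%:C *
      \sum_(m <- s) b m * \prod_i X t i ^+ m i : R[i]^o) @[t --> F]
   --> (\sum_(m <- s | G m) b m * \prod_i y0 i ^+ m i : R[i]^o)).
Proof.
move=> sG snG; rewrite big_mkcond.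
under eq_fun do rewrite mulr_sumr.
apply: cvgc_sum => m ms.
have E t : (expR (- dotp (p t) (exponent R m0)))%:C * (b m * \prod_i X t i ^+ m i) =
   (expR (dotp (p t) (exponent R m) - dotp (p t) (exponent R m0)))%:C *
   (b m * \prod_i y t i ^+ m i).
  by rewrite monomial_scaling expRD rmorphM /=; ring.
have cb : ((b m : R[i]^o) @[_ --> F] --> (b m : R[i]^o)) by exact: cvg_cst.
have cm : ((b m * \prod_i y t i ^+ m i : R[i]^o) @[t --> F] -->
    (b m * \prod_i y0 i ^+ m i : R[i]^o)).
  exact: (cvgcM cb (cvgc_monomial (m := m) yy0)).
under eq_fun do rewrite E.
pose w t := expR (dotp (p t) (exponent R m) - dotp (p t) (exponent R m0)).
have [Gm|nGm] := boolP (G m).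
  have w1 : w @ F --> (1 : R).
    apply: cvg_near_cst; apply: filterS (sG m ms Gm) => t.
    by rewrite /w => ->; rewrite subrr expR0.
  have := @cvgc_real _ _ _ FF _ _ w1; rewrite rmorph1 => w1c.
  by rewrite -[b m * \prod_i y0 i ^+ m i]mul1r; exact: (cvgcM w1c cm).
have w0 : w @ F --> (0 : R).
  apply/cvgrPdist_le => e e0.
  have /cvgrNyPle/(_ (ln e)) := snG m ms nGm; apply: filterS => t te.
  by rewrite sub0r normrN ger0_norm ?expR_ge0 // -[leRHS]lnK ?posrE // ler_expR.
have := @cvgc_real _ _ _ FF _ _ w0; rewrite rmorph0 => w0c.
by rewrite -(mul0r (b m * \prod_i y0 i ^+ m i)); exact: (cvgcM w0c cm).
Qed.

End DominantTerms.

(** * Families of points in the torus *)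

Section TorusLimit.
Local Open Scope complex_scope.
Variables (R : realType) (n : nat) (T : Type) (U : set_system T).
Hypothesis UU : UltraFilter U.
Let UP : ProperFilter U := @ultra_proper _ _ UU.
Existing Instance UP.

(** The vector p is the rectification of the logarithms of the moduli, so the
    moduli of the y_i are bounded above and away from 0: they converge, and the
    limits are nonzero. *)
Lemma torus_rescaling (X : T -> 'I_n -> R[i]) : (forall t i, X t i != 0) ->
  exists (p : T -> 'rV[R]_n) (y : T -> 'I_n -> R[i]) (y0 : 'I_n -> R[i]),
  [/\ forall t i, X t i = (expR (p t 0 i))%:C * y t i,
      forall i, (y t i : R[i]^o) @[t --> U] --> (y0 i : R[i]^o),
      torus y0,
      forall u, bounded_along U (fun t => dotp (p t) u) ->
        forall t, dotp (p t) u = 0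
    & forall i, Normc.normc (X t i) @[t --> U] --> +oo ->
        p t 0 i @[t --> U] --> +oo].
Proof.
move=> X0; pose l t : 'rV[R]_n := \row_i ln (Normc.normc (X t i)).
have nX0 t i : 0 < Normc.normc (X t i).
  rewrite lt_neqAle normc_ge0 andbT eq_sym; apply: contra (X0 t i) => /eqP X0'.
  by rewrite (Normc.eq0_normc X0').
have [p [lp prel]] := rectification UU l.
pose y t i : R[i] := (expR (- p t 0 i))%:C * X t i.
have ny t i : Normc.normc (y t i) = expR (l t 0 i - p t 0 i).
  rewrite Normc.normcM addrC expRD mxE lnK ?posrE //; congr (_ * _).
  by rewrite normc_real ger0_norm // expR_ge0.
have [M HM] := choice lp.
have yb i : bounded_along U (fun t => Normc.normc (y t i)).
  exists (expR (M i)); apply: filterS (HM i) => t tM.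
  rewrite ger0_norm ?normc_ge0 // ny ler_expR.
  exact: le_trans (ler_norm _) tM.
have [y0 yy0] := choice (fun i => bounded_cvgc UU (yb i)).
exists p, y, y0; split=> //.
- by move=> t i; rewrite mulrA -rmorphM /= -expRD subrr expR0 mul1r.
- move=> i; apply/eqP => y0i; have := yy0 i; rewrite y0i => /cvgc_distP.
  (* A limit 0 would bring the modulus of y_i below half its lower bound. *)
  have e0 : 0 < expR (- M i) / 2 by rewrite divr_gt0 ?expR_gt0.
  move=> /(_ _ e0) ye; have [t [/= te tM]] := filter_ex (filterI ye (HM i)).
  move: te; rewrite subr0 ny; apply/negP; rewrite -ltNge.
  apply: (@lt_le_trans _ _ (expR (- M i))).
    by have := expR_gt0 (- M i); lra.
  by rewrite ler_expR; move: tM; rewrite ler_norml => /andP[].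
- move=> u [N uN] t; rewrite dotpC; apply: prel.
  have [K uK] := @bounded_along_sum R T U UU _ (index_enum _)
    (fun i t => u 0 i * (l t 0 i - p t 0 i))
    (fun i => bounded_alongZ UU (u 0 i) (lp i)).
  exists (N + K); apply: filterS2 uN uK => s uN uK.
  have -> : dotp u (l s) = dotp (p s) u + \sum_i u 0 i * (l s 0 i - p s 0 i).
    rewrite dotpC /dotp -big_split; apply: eq_bigr => i _ /=; ring.
  by apply: le_trans (ler_normD _ _) _; apply: lerD.
- move=> i /cvgryPge Xy; apply: pinfty_shift (lp i) _; apply/cvgryPge => A.
  apply: filterS (Xy (expR A)) => t; rewrite mxE -[A in _ -> A <= _]expRK => XA.
  by rewrite ler_ln ?posrE ?expR_gt0.
Qed.

(** At each t one of finitely many vectors is maximal; the ultrafilter selects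
    one that works for almost all t. *)
Lemma ultra_argmax (s : seq 'rV[R]_n) (p : T -> 'rV[R]_n) : s != [::] ->
  exists2 a, a \in s & \forall t \near U, {in s, forall x, dotp (p t) x <= dotp (p t) a}.
Proof.
case: s => [//|x0 s] _; set s' := x0 :: s.
have : \forall t \near U, exists k : 'I_(size s).+1,
    {in s', forall x, dotp (p t) x <= dotp (p t) (nth 0 s' k)}.
  apply: filterE => t.
  case: (@Order.TotalTheory.arg_maxP _ R 'I_(size s).+1 ord0 xpredT
    (fun k => dotp (p t) (nth 0 s' k)) isT) => k _ kmax.
  exists k => x xs; have xi : (index x s' < (size s).+1)%N by rewrite index_mem.
  by have := kmax (Ordinal xi) isT; rewrite /= nth_index.
move=> /(ultra_pigeonhole UU)[k kmax].
by exists (nth 0 s' k); first exact: mem_nth.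
Qed.

Variables (f : {mpoly R[i][n]}) (X : T -> 'I_n -> R[i]) (c : R[i]).
Hypothesis dimf : has_dim (newton f) n.
Hypothesis ndf : nondegenerate_at_infinity f.
Hypothesis X_torus : forall t i, X t i != 0.
Hypothesis X_infty : euclidean_norm (X t) @[t --> U] --> +oo.
Hypothesis df0 : forall i, (X t i * (f^`M(i)).@[X t] : R[i]^o) @[t --> U] --> (0 : R[i]^o).
Hypothesis fc : (f.@[X t] : R[i]^o) @[t --> U] --> (c : R[i]^o).

(** The alternative follows the behaviour of <p, m0>, where m0 is a dominant
    exponent of f: bounded, tending to +oo (excluded by nondegeneracy), or
    tending to -oo. *)
Lemma torus_limit : c = 0 \/ exists2 F, bad_face f F &
  exists2 y, (Sing (face_part f F) `&` @torus R n) y & (face_part f F).@[y] = c.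
Proof.
have [p [y [y0 [Xy yy0 y0T prel pinf]]]] := torus_rescaling X_torus.
have XE : X = fun t i => (expR (p t 0 i))%:C * y t i.
  by apply/funext => t; apply/funext => i.
have [i1 /pinf pi1] := norm_pinfty_coord UU X_infty.
(* There is a dominant exponent as soon as f is nonzero. *)
have [f0|] := eqVneq (map (@exponent R n) (msupp f)) [::].
  left; apply: cvgc_unique fc _.
  have -> : f = 0 by apply: msuppnil0; case: (msupp f) f0.
  by under eq_fun do rewrite meval0; exact: cvg_cst.
move=> /(@ultra_argmax _ p)[_ /mapP[m0 m0f ->] m0max].
pose E (m : 'X_{1..n}) := exponent R m.
pose G (m : 'X_{1..n}) := `[< bounded_along U (fun t => dotp (p t) (E m - E m0)) >].
have dB t u v : dotp (p t) (u - v) = dotp (p t) u - dotp (p t) v.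
  by rewrite dotpDr -scaleN1r dotpZr mulN1r.
have GE m : G m -> forall t, dotp (p t) (E m) = dotp (p t) (E m0).
  by move=> /asboolP/prel mm0 t; apply/eqP; rewrite -subr_eq0 -dB mm0.
have nGE m : m \in msupp f -> ~~ G m ->
    dotp (p t) (E m) - dotp (p t) (E m0) @[t --> U] --> -oo.
  move=> mf nG; under eq_fun do rewrite -dB.
  have [bd|/cvgryPgt/(_ 0) py|//] := ultra_trichotomy UU (fun t => dotp (p t) (E m - E m0)).
    by case/asboolP: nG.
  have [t [/= tp /(_ _ (map_f _ mf))]] := filter_ex (filterI py m0max).
  by rewrite -subr_le0 -dB leNgt tp.
(* For almost all t, the hyperplane orthogonal to p t through m0 meets the
   support exactly in G. *)
have sep : \forall t \near U, {in msupp f, forall m,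
    G m = (dotp (p t) (E m) == dotp (p t) (E m0))}.
  apply: near_all_in => m mf; have [Gm|nGm] := boolP (G m).
    by apply: filterE => t; apply/esym/eqP; exact: GE.
  have /cvgrNyPlt/(_ 0) := nGE m mf nGm; apply: filterS => t mt.
  by apply/esym; rewrite -subr_eq0; apply/negbTE; rewrite lt_eqF.
pose mu t := dotp (p t) (E m0).
have lim b : (((expR (- mu t))%:C *
      \sum_(m <- msupp f) b m * \prod_i X t i ^+ m i : R[i]^o) @[t --> U]
   --> (\sum_(m <- msupp f | G m) b m * \prod_i y0 i ^+ m i : R[i]^o)).
  rewrite XE; apply: (dominant_terms yy0) => m mf.
    by move=> Gm; apply: filterE => t; exact: GE.
  exact: nGE.
(* The next facts hold for the two polyhedra alike, hence the arbitrary P. The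
   form - p t is used because faces are sets of minima. *)
have faceE t (P : set 'rV[R]_n) :
   (forall m, m \in msupp f -> G m = (dotp (p t) (E m) == mu t)) ->
   (forall m, m \in msupp f -> P (E m)) ->
   {in msupp f, forall m,
     `[< (P `&` [set x | dotp (- p t) x = - mu t]) (E m) >] = G m}.
  move=> Gt Pm m mf; rewrite Gt //; apply/asboolP/eqP => [[_ /=]|mE].
    by rewrite dotpNl => /oppr_inj.
  by split; [exact: Pm|rewrite /= dotpNl mE].
have faceP t (P : set 'rV[R]_n) : P (E m0) -> (forall x, P x -> - mu t <= dotp (- p t) x) ->
  is_face P (P `&` [set x | dotp (- p t) x = - mu t]).
  move=> Pm0 Pge; split; first by exists (E m0); split=> //=; rewrite dotpNl.
  by exists (- p t), (- mu t).
have supp_ge t : {in map E (msupp f), forall x, dotp (p t) x <= mu t} ->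
   forall x, supp f x -> - mu t <= dotp (- p t) x.
  by move=> max_t _ [m mf <-]; rewrite dotpNl lerN2 max_t ?map_f.
have newton_ge t : {in map E (msupp f), forall x, dotp (p t) x <= mu t} ->
    forall x, newton f x -> - mu t <= dotp (- p t) x.
  by move=> max_t; exact: convex_hull_ge (supp_ge t max_t).
have faceS F (b : 'X_{1..n} -> R[i]) :
    {in msupp f, forall m, `[< F (E m) >] = G m} ->
    \sum_(m <- msupp f | `[< F (E m) >]) b m = \sum_(m <- msupp f | G m) b m.
  move=> FG; rewrite big_seq_cond [RHS]big_seq_cond; apply: eq_bigl => m.
  by case mf: (m \in msupp f) => //=; exact: FG.
(* ev i is the value at y0 of y_i times the i-th derivative of the face part. *)
pose ev i := \sum_(m <- msupp f | G m) f@_m * (m i)%:R * \prod_j y0 j ^+ m j.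
have singF F : {in msupp f, forall m, `[< F (E m) >] = G m} ->
    (forall i, ev i = 0) -> Sing (face_part f F) y0.
  move=> FG ev0 i; have := face_part_euler f F y0 i.
  by rewrite faceS // [RHS]ev0 => /eqP; rewrite mulf_eq0 (negbTE (y0T i)) => /eqP.
have [mu_b|mu_p|mu_n] := ultra_trichotomy UU mu.
- have mu0 t : mu t = 0 by exact: prel.
  have lim0 b : ((\sum_(m <- msupp f) b m * \prod_i X t i ^+ m i : R[i]^o) @[t --> U]
      --> (\sum_(m <- msupp f | G m) b m * \prod_i y0 i ^+ m i : R[i]^o)).
    have := lim b; under eq_fun do rewrite mu0 oppr0 expR0 rmorph1 mul1r.
    exact.
  have cE : c = \sum_(m <- msupp f | G m) f@_m * \prod_i y0 i ^+ m i.
    apply: cvgc_unique fc _; under eq_fun do rewrite mevalE.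
    exact: (lim0 (fun m => f@_m)).
  have ev0 i : ev i = 0.
    apply: cvgc_unique (lim0 (fun m => f@_m * (m i)%:R)) _.
    by have := df0 i; under eq_fun do rewrite euler.
  have /cvgryPgt/(_ 0) pi1_gt := pi1.
  have [t [Gt [max_t pt]]] := filter_ex (filterI sep (filterI m0max pi1_gt)).
  pose F := newton f `&` [set x | dotp (- p t) x = - mu t].
  have FG := faceE t (newton f) Gt (@newton_msupp _ _ f).
  have m0F : F (E m0).
    by split; [exact: newton_msupp|rewrite /= dotpNl].
  have [|hull0|[w [w0 wF]]] := @affine_hull0_or_weight R n F
      (map E (seq.filter G (msupp f))) (E m0) m0F.
  + move=> _ /mapP[m + ->]; rewrite mem_filter => /andP[Gm mf].
    by apply/asboolP; rewrite FG.
  + right; exists F; last first.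
      exists y0; first by split; [exact: singF|].
      by rewrite face_part_meval (faceS F (fun m => f@_m * _)).
    split=> //; first exact: faceP (newton_msupp m0f) (newton_ge t max_t).
    exists (p t); split.
      rewrite /F mu0 setIC; congr (_ `&` _); apply/seteqP.
      split=> x /=; rewrite dotpNl oppr0; last by move=> ->; rewrite oppr0.
      by move/eqP; rewrite oppr_eq0 => /eqP.
    (* Otherwise p t is nonnegative, and so is its pairing with every exponent;
       as the maximum is 0, p t vanishes on the support. *)
    have [j pj] : exists j, p t 0 j < 0.
      apply: contrapT => p_ge0; have : p t = 0.
        apply: (full_dim_dotp_eq0 dimf) => m mf; apply: le_anti; apply/andP; split.
          by rewrite -(mu0 t); apply: max_t; exact: map_f.
        apply: sumr_ge0 => j _; rewrite mxE mulr_ge0 // leNgt; apply/negP => pj.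
        by apply: p_ge0; exists j.
      by move=> p0; move: pt; rewrite /= p0 mxE ltxx.
    exists i1, j; split; last by rewrite pmulr_rlt0.
    by apply: contraTneq pj => <-; rewrite -leNgt ltW.
  + (* Weighted sum of the Euler relations, with weights w. *)
    left; apply/eqP; have : (dotp w (E m0))%:C * c = 0.
      have -> : (dotp w (E m0))%:C * c = \sum_i (w 0 i)%:C * ev i.
        rewrite cE mulr_sumr; under [RHS]eq_bigr do rewrite mulr_sumr.
        rewrite exchange_big /= big_seq_cond [RHS]big_seq_cond.
        apply: eq_bigr => m /andP[mf Gm].
        rewrite -(wF (E m)); last by apply: map_f; rewrite mem_filter Gm.
        rewrite /dotp rmorph_sum mulr_suml; apply: eq_bigr => i _.
        by rewrite mxE rmorphM /= rmorph_nat; ring.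
      by rewrite big1 // => i _; rewrite ev0 mulr0.
    by move/eqP; rewrite mulf_eq0 fmorph_eq0 (negbTE w0).
- (* Here G is a face of the polyhedron at infinity: the origin pairs to 0 with
     p t, below the maximum mu t. *)
  exfalso.
  have emu0 : (fun t => expR (- mu t)) @ U --> (0 : R).
    apply/cvgrPdist_le => e e0.
    have /cvgryPge/(_ (- ln e)) := mu_p; apply: filterS => t te.
    rewrite sub0r normrN ger0_norm ?expR_ge0 // -[leRHS]lnK ?posrE // ler_expR.
    by rewrite lerNl.
  have emu0c : (((expR (- mu t))%:C : R[i]^o) @[t --> U] --> (0%:C : R[i]^o)).
    exact: cvgc_real.
  have ev0 i : ev i = 0.
    apply: cvgc_unique (lim (fun m => f@_m * (m i)%:R)) _.
    have := df0 i; under eq_fun do rewrite euler.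
    move=> dfi.
    have h : (((expR (- mu t))%:C * \sum_(m <- msupp f) f@_m * (m i)%:R *
        \prod_j X t j ^+ m j : R[i]^o) @[t --> U] --> (0%:C * 0 : R[i]^o)).
      exact: (cvgcM emu0c dfi).
    by rewrite mulr0 in h.
  have /cvgryPgt/(_ 0) mu_gt0 := mu_p.
  have [t [Gt [max_t mut]]] := filter_ex (filterI sep (filterI m0max mu_gt0)).
  pose F := newton_infty f `&` [set x | dotp (- p t) x = - mu t].
  have FG := faceE t (newton_infty f) Gt (@newton_infty_msupp _ _ f).
  have Fface : is_face (newton_infty f) F.
    apply: faceP (newton_infty_msupp m0f) _; apply: convex_hull_ge => x [|->].
      exact: supp_ge.
    by rewrite dotpC dotp0l oppr_le0 ltW.
  have nF0 : ~ F 0.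
    by move=> [_ /=]; rewrite dotpC dotp0l => /esym/eqP; rewrite oppr_eq0 gt_eqF.
  have : (Sing (face_part f F) `&` @torus R n) y0 by split; [exact: singF|].
  by rewrite ndf.
- left.
  have emu0 : (fun t => expR (mu t)) @ U --> (0 : R).
    apply/cvgrPdist_le => e e0.
    have /cvgrNyPle/(_ (ln e)) := mu_n; apply: filterS => t te.
    by rewrite sub0r normrN ger0_norm ?expR_ge0 // -[leRHS]lnK ?posrE // ler_expR.
  have emu0c : (((expR (mu t))%:C : R[i]^o) @[t --> U] --> (0%:C : R[i]^o)).
    exact: cvgc_real.
  apply: cvgc_unique fc _.
  have fE t : f.@[X t] = (expR (mu t))%:C * ((expR (- mu t))%:C *
      \sum_(m <- msupp f) f@_m * \prod_i X t i ^+ m i).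
    by rewrite mulrA -rmorphM /= -expRD subrr expR0 mul1r mevalE.
  under eq_fun do rewrite fE.
  have h : (((expR (mu t))%:C * ((expR (- mu t))%:C *
      \sum_(m <- msupp f) f@_m * \prod_i X t i ^+ m i) : R[i]^o) @[t --> U]
      --> (0%:C * \sum_(m <- msupp f | G m) f@_m * \prod_i y0 i ^+ m i : R[i]^o)).
    exact: (cvgcM emu0c (lim (fun m => f@_m))).
  by rewrite mul0r in h.
Qed.

End TorusLimit.

(** * Reduction to the torus *)

Section Perturbation.
Local Open Scope complex_scope.
Variables (R : realType) (n : nat).

(** Replacing the zero coordinates by a small positive real moves the values of
    finitely many polynomials as little as desired. *)
Lemma torus_approximation (gs : seq {mpoly R[i][n]}) (x : 'I_n -> R[i]) (e : R) :
  0 < e -> exists x' : 'I_n -> R[i],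
  [/\ torus x', euclidean_norm x <= euclidean_norm x'
    & {in gs, forall g, Normc.normc (g.@[x'] - g.@[x]) <= e}].
Proof.
move=> e0; pose z (s : R) i : R[i] := if x i == 0 then s%:C else x i.
have zx i : (z s i : R[i]^o) @[s --> (0 : R)^'+] --> (x i : R[i]^o).
  rewrite /z; case: eqP => [->|_]; last exact: cvg_cst.
  apply: (@cvgc_real _ _ _ _ id 0); exact: cvg_at_right_filter.
have [s [s0 zs]] : exists s : R, 0 < s /\
    {in gs, forall g, Normc.normc (g.@[z s] - g.@[x]) <= e}.
  apply: (@filter_ex _ (0 : R)^'+); apply: filterI; first exact: nbhs_right_gt.
  apply: (@near_all_in _ (0 : R)^'+ _ _ gs
    (fun g s => Normc.normc (g.@[z s] - g.@[x]) <= e)) => g _.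
  have gz : ((g.@[z s] : R[i]^o) @[s --> (0 : R)^'+] --> (g.@[x] : R[i]^o)).
    exact: cvgc_meval zx.
  by move/cvgc_distP: gz; apply.
exists (z s); split=> //.
  by move=> i; rewrite /z; case: (eqVneq (x i)) => // _; rewrite fmorph_eq0 gt_eqF.
rewrite /euclidean_norm ler_wsqrtr // ler_sum // => i _; rewrite /z.
by case: eqP => // ->; rewrite Normc.normc0 expr0n sqr_ge0.
Qed.

End Perturbation.

Unset Implicit Arguments.
Set Strict Implicit.
Set Printing Implicit Defensive.

Theorem corollary3p2 (R : realType) (n : nat) (f : {mpoly R[i][n]}) :
  f.@[fun _ : 'I_n => 0] = 0 ->
  has_dim (newton f) n ->
  nondegenerate_at_infinity f ->
  Kinfty f `<=`
    \bigcup_(F in bad_face f)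
      ((fun x : 'I_n -> R[i] => (face_part f F).@[x]) @`
         (Sing (face_part f F) `&` @torus R n))
    `|` [set 0].
Proof.
move=> _ dimf ndf c [X [_ X_infty df0 fc]].
pose gs := f :: [seq 'X_i * f^`M(i) | i <- enum 'I_n].
have approx t : exists x' : 'I_n -> R[i], [/\ torus x',
    euclidean_norm (X t) <= euclidean_norm x'
    & 0 < t -> {in gs, forall g, Normc.normc (g.@[x'] - g.@[X t]) <= t}].
  have [t0|t0] := ltP 0 t.
    by have [x' [? ? ?]] := torus_approximation gs (X t) t0; exists x'.
  (* Such t lie outside every right neighbourhood of 0. *)
  have [x' [? ? _]] := torus_approximation gs (X t) (@ltr01 R).
  by exists x'; split=> // /(le_lt_trans t0); rewrite ltxx.
have [X' X'P] := choice approx.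
have [U [UU sU]] := @ultraFilterLemma R (0 : R)^'+ _.
have X'cvg g (l : R[i]) : g \in gs ->
    ((g.@[X t] : R[i]^o) @[t --> (0 : R)^'+] --> (l : R[i]^o)) ->
    ((g.@[X' t] : R[i]^o) @[t --> U] --> (l : R[i]^o)).
  move=> ggs /cvgc_distP gl; apply/cvgc_distP => e e0; apply: sU.
  have e2 : 0 < e / 2 by rewrite divr_gt0.
  near=> t.
  have t0 : 0 < t by near: t; exact: nbhs_right_gt.
  have te : t <= e / 2 by near: t; exact: nbhs_right_le.
  have gXl : Normc.normc (g.@[X t] - l) <= e / 2 by near: t; exact: gl.
  have [_ _ /(_ t0 _ ggs) gX'] := X'P t.
  rewrite -(subrK g.@[X t] g.@[X' t]) -addrA.
  by apply: le_trans (le_normcD _ _) _; lra.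
have [] := @torus_limit R n R U UU f X' c dimf ndf.
- by move=> t; have [] := X'P t.
- apply/cvgryPge => A; have /cvgryPge/(_ A) AX := X_infty.
  apply: sU; apply: filterS AX => t AX; apply: le_trans AX _.
  by have [] := X'P t.
- move=> i; have gi : 'X_i * f^`M(i) \in gs.
    by rewrite in_cons (map_f (fun i => 'X_i * f^`M(i))) ?orbT // mem_enum.
  have E x : ('X_i * f^`M(i)).@[x] = x i * (f^`M(i)).@[x] by rewrite mevalM mevalXU.
  have Xlim : ((('X_i * f^`M(i)).@[X t] : R[i]^o) @[t --> (0 : R)^'+] --> (0 : R[i]^o)).
    by under eq_fun do rewrite E; exact: df0.
  by have := X'cvg _ 0 gi Xlim; under eq_fun do rewrite E.
- by apply: X'cvg fc; exact: mem_head.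
- by move=> ->; right.
- by move=> [F badF [y ySing yc]]; left; exists F => //; exists y.
Unshelve. all: by end_near. Qed.
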